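(* Let $K$ be a field, let $A$, $B$, $C$ be $K$-algebras with $B$ and $C$ finite dimensional, and let $D:=B\times C$. Let $\psi\colon A\otimes D\to D\otimes A$ be a $K$-linear map and let $\tilde\gamma_i^j\colon A\to A$ ($1\le i,j\le m+n$) be the maps determined by $\psi(a\otimes d_i)=\sum_{j=1}^{m+n}d_j\otimes\tilde\gamma_i^j(a)$. Let $i_B\colon B\to D$ and $p_B\colon D\to B$ be the canonical inclusion and the canonical surjection, and suppose that the map $\Theta:=(p_B\otimes A)\circ\psi\circ(A\otimes i_B)$ is a twisting map. Then $\psi$ is a twisting map if and only if the following conditions are satisfied (with the bases, scalars and matrices $B_k^{(2)}$, $C_k^{(1)}$, $C_k^{(2)}$, $\Gamma^p_q(a)$ defined in the context): - $B_i^{(2)}B_j^{(2)}=\sum_{k=1}^n\lambda_{ji}^kB_k^{(2)}$ for $1\le i,j\le n$; - $C_j^{(1)}=0$ for $1\le j\le m$; - $C_i^{(2)}C_j^{(2)}=\sum_{k=1}^m\eta_{ji}^kC_k^{(2)}$ for $1\le i,j\le m$; - $B_i^{(2)}C_j^{(2)}=C_j^{(2)}B_i^{(2)}=0$ for $1\le i\le n$ and $1\le j\le m$; - $\sum_{i=1}^n\alpha_iB_i^{(2)}+\sum_{j=1}^m\beta_jC_j^{(2)}=\mathrm{id}_{M_m(E)}$; - $\Gamma^0_1=0$; - $\Gamma^1_1(aa')=\Gamma^1_1(a)\Gamma^1_1(a')$ for $a,a'\in A$; - $\Gamma^1_0(aa')=\Gamma^1_0(a)\Gamma^0_0(a')+\Gamma^1_1(a)\Gamma^1_0(a')$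 for $a,a'\in A$; - $\Gamma^1_1(1)=I_m$ and $\Gamma^1_0(1)=0$.
   Context: Algebras are associative and unital, algebra morphisms are unital, all maps are $K$-linear, $\otimes=\otimes_K$, and an algebra used as a map denotes its identity map. A twisting map for algebras $A$, $B$ is a $K$-linear map $\chi\colon A\otimes B\to B\otimes A$ such that $\chi(1\otimes b)=b\otimes1$, $\chi(a\otimes1)=1\otimes a$ for all $a,b$; $\chi\circ(\mu_A\otimes B)=(B\otimes\mu_A)\circ(\chi\otimes A)\circ(A\otimes\chi)$; and $\chi\circ(A\otimes\mu_B)=(\mu_B\otimes A)\circ(B\otimes\chi)\circ(\chi\otimes B)$, where $\mu$ denotes multiplication. Bases $\mathcal{B}=\{b_1,\dots,b_n\}$ of $B$ and $\mathcal{C}=\{c_1,\dots,c_m\}$ of $C$ are fixed; identifying $b_i$ with $(b_i,0)$ and $c_i$ with $(0,c_i)$, the ordered basis of $D$ is $\{d_1,\dots,d_{m+n}\}$ with $d_i=b_i$ for $i\le n$ and $d_i=c_{i-n}$ for $i>n$. Structure constants: $b_ib_j=\sum_k\lambda_{ij}^kb_k$, $c_ic_j=\sum_k\eta_{ij}^kc_k$. Scalars $\alpha_i,\beta_j$ are given by $1_D=(1_B,1_C)=\sum_{k=1}^n\alpha_kb_k+\sum_{l=1}^m\beta_lc_l$. Let $E:=\operatorname{End}_K(A)$ (product is composition). The following matrices over $E$ are defined by their $(p,q)$ entries: for $1\le k\le n$, $B_k^{(2)}\in M_m(E)$ has entries $\sum_{l=1}^m\eta_{ql}^p\,\tilde\gamma_k^{l+n}$;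 for $1\le k\le m$, $C_k^{(1)}\in M_n(E)$ has entries $\sum_{l=1}^n\lambda_{ql}^p\,\tilde\gamma_{k+n}^l$ and $C_k^{(2)}\in M_m(E)$ has entries $\sum_{l=1}^m\eta_{ql}^p\,\tilde\gamma_{k+n}^{l+n}$. For $a\in A$, the matrix $(\tilde\gamma_j^i(a))_{1\le i,j\le m+n}\in M_{m+n}(A)$ ($i$ the row, $j$ the column) is written in blocks as $\begin{pmatrix}\Gamma^0_0(a)&\Gamma^0_1(a)\\ \Gamma^1_0(a)&\Gamma^1_1(a)\end{pmatrix}$ with $\Gamma^0_0(a)\in M_n(A)$, $\Gamma^0_1(a)\in M_{n\times m}(A)$, $\Gamma^1_0(a)\in M_{m\times n}(A)$, $\Gamma^1_1(a)\in M_m(A)$. $\mathrm{id}_{M_m(E)}$ is the identity matrix of $M_m(E)$, and $I_m$ that of $M_m(A)$. *)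

(* Defs.v *)
From HB Require Import structures.
From mathcomp Require Import all_boot all_algebra all_field.
From mathcomp Require Import boolp finmap monalg.

Set Implicit Arguments.
Unset Strict Implicit.
Unset Printing Implicit Defensive.

Import GRing.Theory.
Local Open Scope ring_scope.
Local Open Scope quotient_scope.

Reserved Notation "x \ox y" (at level 40, left associativity).

(* The K-algebra End_K(V), with composition as product. *)
Section LinearEndomorphisms.
Context (K : fieldType) (V : lmodType K).
Notation E := {linear V -> V}.
Implicit Types f g h : E.

HB.instance Definition _ := gen_eqMixin E.
HB.instance Definition _ := gen_choiceMixin E.

Lemma linendP f g : f =1 g -> f = g.
Proof.
case: f g => [f cf] [g cg] /= fg.
have {}fg : f = g by apply: funext.
subst g; case: cf cg => [[a1] [a2]] [[b1] [b2]].
by rewrite (Prop_irrelevance a1 b1) (Prop_irrelevance a2 b2).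
Qed.

Definition linend_zero : E := \0.
Definition linend_opp f : E := \- f.
Definition linend_add f g : E := f \+ g.
Definition linend_scale (k : K) f : E := k \*: f.
Definition linend_one : E := idfun.
Definition linend_mul f g : E := f \o g.

Fact linend_addA : associative linend_add.
Proof. by move=> f g h; apply: linendP => x /=; rewrite addrA. Qed.
Fact linend_addC : commutative linend_add.
Proof. by move=> f g; apply: linendP => x /=; rewrite addrC. Qed.
Fact linend_add0 : left_id linend_zero linend_add.
Proof. by move=> f; apply: linendP => x /=; rewrite add0r. Qed.
Fact linend_addN : left_inverse linend_zero linend_opp linend_add.
Proof. by move=> f; apply: linendP => x /=; rewrite addNr. Qed.

HB.instance Definition _ := GRing.isZmodule.Build E
  linend_addA linend_addC linend_add0 linend_addN.

Fact linend_mulA : associative linend_mul.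
Proof. by move=> f g h; apply: linendP. Qed.
Fact linend_mul1 : left_id linend_one linend_mul.
Proof. by move=> f; apply: linendP. Qed.
Fact linend_1mul : right_id linend_one linend_mul.
Proof. by move=> f; apply: linendP. Qed.
Fact linend_mulDl : left_distributive linend_mul +%R.
Proof. by move=> f g h; apply: linendP. Qed.
Fact linend_mulDr : right_distributive linend_mul +%R.
Proof. by move=> f g h; apply: linendP => x; rewrite /= raddfD. Qed.

HB.instance Definition _ := GRing.Zmodule_isPzRing.Build E
  linend_mulA linend_mul1 linend_1mul linend_mulDl linend_mulDr.

Fact linend_scaleA k l f :
  linend_scale k (linend_scale l f) = linend_scale (k * l) f.
Proof. by apply: linendP => x; rewrite /= scalerA. Qed.
Fact linend_scale1 : left_id 1 linend_scale.
Proof. by move=> f; apply: linendP => x; rewrite /= scale1r. Qed.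
Fact linend_scaleDr : right_distributive linend_scale +%R.
Proof. by move=> k f g; apply: linendP => x; rewrite /= scalerDr. Qed.
Fact linend_scaleDl f : {morph linend_scale^~ f : k l / k + l}.
Proof. by move=> k l; apply: linendP => x; rewrite /= scalerDl. Qed.

HB.instance Definition _ := GRing.Zmodule_isLmodule.Build K E
  linend_scaleA linend_scale1 linend_scaleDr linend_scaleDl.

Lemma linend0E x : (0 : E) x = 0. Proof. by []. Qed.
Lemma linendNE f x : (- f) x = - f x. Proof. by []. Qed.
Lemma linendDE f g x : (f + g) x = f x + g x. Proof. by []. Qed.
Lemma linend1E x : (1 : E) x = x. Proof. by []. Qed.
Lemma linendME f g x : (f * g) x = f (g x). Proof. by []. Qed.
Lemma linendZE k f x : (k *: f) x = k *: f x. Proof. by []. Qed.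

Lemma linend_sumE I (r : seq I) (P : pred I) (F : I -> E) x :
  (\sum_(i <- r | P i) F i) x = \sum_(i <- r | P i) F i x.
Proof. by elim/big_ind2: _ => // f a g c <- <-. Qed.

End LinearEndomorphisms.

(* The quotient of the free K-module on M * N by the submodule generated by
   the bilinearity relations. *)
Section TensorQuotient.
Context (K : fieldType) (M N : lmodType K).
Notation F := {malg K[(M * N)%type]}.

Inductive tensor_rel : F -> Prop :=
| tensor_rel_l k m m' n : tensor_rel
    (<< (k *: m + m', n) >> - (k *: << (m, n) >> + << (m', n) >>))
| tensor_rel_r k m n n' : tensor_rel
    (<< (m, k *: n + n') >> - (k *: << (m, n) >> + << (m, n') >>))
| tensor_rel_0 : tensor_rel 0
| tensor_rel_ZD k u v : tensor_rel u -> tensor_rel v -> tensor_rel (k *: u + v).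

Definition tensor_ker : {pred F} := fun u => `[< tensor_rel u >].

Fact tensor_ker_submod_closed : submod_closed tensor_ker.
Proof.
split=> [|k u v /asboolP Ru /asboolP Rv]; apply/asboolP.
  exact: tensor_rel_0.
exact: tensor_rel_ZD.
Qed.

HB.instance Definition _ :=
  GRing.isSubmodClosed.Build K F tensor_ker tensor_ker_submod_closed.

Definition tensor_quot := Quotient.quot tensor_ker.

HB.instance Definition _ := GRing.Zmodule.on tensor_quot.

Implicit Types x y : tensor_quot.

Lemma tensorW (P : tensor_quot -> Prop) : (forall u, P (\pi_tensor_quot u)) -> forall x, P x.
Proof. by move=> Pu x; rewrite -[x]reprK. Qed.

Definition tensor_scale (k : K) x : tensor_quot := \pi_tensor_quot (k *: repr x).

Lemma pi_tensorB u v : (\pi_tensor_quot u == \pi_tensor_quot v) = (u - v \in tensor_ker).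
Proof. by rewrite Quotient.idealrBE. Qed.

Fact pi_tensorZ k (u : F) : \pi_tensor_quot (k *: u) = tensor_scale k (\pi_tensor_quot u).
Proof.
apply/eqP; rewrite pi_tensorB -scalerBr rpredZ //.
by rewrite -pi_tensorB reprK.
Qed.

Fact pi_tensorD (u v : F) : \pi_tensor_quot (u + v) = \pi_tensor_quot u + \pi_tensor_quot v.
Proof. by rewrite piE. Qed.

Fact pi_tensor0 : \pi_tensor_quot 0 = 0.
Proof. by apply: (addrI (\pi_tensor_quot 0)); rewrite -pi_tensorD !addr0. Qed.

Fact tensor_scaleA k l x :
  tensor_scale k (tensor_scale l x) = tensor_scale (k * l) x.
Proof. by elim/tensorW: x => u; rewrite -!pi_tensorZ scalerA. Qed.
Fact tensor_scale1 : left_id 1 tensor_scale.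
Proof. by elim/tensorW=> u; rewrite -pi_tensorZ scale1r. Qed.
Fact tensor_scaleDr : right_distributive tensor_scale +%R.
Proof.
move=> k; elim/tensorW=> u; elim/tensorW=> v.
by rewrite -pi_tensorD -!pi_tensorZ scalerDr pi_tensorD.
Qed.
Fact tensor_scaleDl x : {morph tensor_scale^~ x : k l / k + l}.
Proof.
by elim/tensorW: x => u k l; rewrite -!pi_tensorZ scalerDl pi_tensorD.
Qed.

HB.instance Definition _ := GRing.Zmodule_isLmodule.Build K tensor_quot
  tensor_scaleA tensor_scale1 tensor_scaleDr tensor_scaleDl.

Fact pi_tensorP : linear (\pi_tensor_quot : F -> tensor_quot).
Proof. by move=> k u v; rewrite pi_tensorD pi_tensorZ. Qed.

Definition quot_tens (m : M) (n : N) : tensor_quot := \pi_tensor_quot << (m, n) >>.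

Fact quot_tens_bilinear : bilinear_for ( *:%R) ( *:%R) quot_tens.
Proof.
split=> [n k m m'|m k n n']; rewrite /= /quot_tens -pi_tensorP; apply/eqP;
  rewrite pi_tensorB; apply/asboolP; [exact: tensor_rel_l|exact: tensor_rel_r].
Qed.

End TensorQuotient.

Section TensorQuotientLift.
Context (K : fieldType) (M N P : lmodType K).
Notation F := {malg K[(M * N)%type]}.

Section Def.
Variables (f : M -> N -> P) (f_bilin : bilinear_for ( *:%R) ( *:%R) f).

Definition free_lift (u : F) : P :=
  \sum_(p <- msupp u) u@_p *: f p.1 p.2.

Lemma free_liftEw (D : {fset (M * N)%type}) u : (msupp u `<=` D)%fset ->
  free_lift u = \sum_(p <- D) u@_p *: f p.1 p.2.
Proof.
move=> sD; rewrite /free_lift (big_fset_incl _ sD) // => p _ /mcoeff_outdom ->.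
exact: scale0r.
Qed.

Lemma free_liftP : linear free_lift.
Proof.
move=> k u v; pose D := (msupp (k *: u + v) `|` (msupp u `|` msupp v))%fset.
rewrite !(@free_liftEw D); last first.
- exact: fsubsetUl.
- by rewrite /D fsubsetU // fsubsetUl orbT.
- by rewrite /D fsubsetU // fsubsetUr orbT.
rewrite scaler_sumr -big_split; apply: eq_bigr => p _ /=.
by rewrite mcoeffD mcoeffZ scalerDl scalerA.
Qed.

HB.instance Definition _ := GRing.isLinear.Build K F P *:%R free_lift free_liftP.

Lemma free_liftU m n : free_lift << (m, n) >> = f m n.
Proof.
rewrite (@free_liftEw [fset (m, n)]%fset) ?msuppU_le //.
by rewrite big_seq_fset1 mcoeffUU scale1r.
Qed.

Lemma free_lift_ker u : u \in @tensor_ker K M N -> free_lift u = 0.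
Proof using f_bilin.
move/asboolP; elim=> {u} [k m m' n|k m n n'||k u v _ u0 _ v0].
- by rewrite linearB linearD linearZ /= !free_liftU (f_bilin.1 n) subrr.
- by rewrite linearB linearD linearZ /= !free_liftU (f_bilin.2 m) subrr.
- exact: linear0.
- by rewrite linearP /= u0 v0 scaler0 addr0.
Qed.

Definition quot_lift (x : tensor_quot M N) : P := free_lift (repr x).

Lemma quot_lift_pi u : quot_lift (\pi u) = free_lift u.
Proof using f_bilin.
apply/eqP; rewrite -subr_eq0 -linearB /=; apply/eqP/free_lift_ker.
by rewrite -pi_tensorB reprK.
Qed.

Fact quot_lift_linear : linear quot_lift.
Proof using f_bilin.
move=> k; elim/tensorW=> u; elim/tensorW=> v.
by rewrite -pi_tensorP !quot_lift_pi free_liftP.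
Qed.

Lemma quot_lift_exists :
  {g : {linear tensor_quot M N -> P} | forall m n, g (quot_tens m n) = f m n}.
Proof using f_bilin.
exists (HB.pack_for {linear tensor_quot M N -> P} quot_lift
  (GRing.isLinear.Build K (tensor_quot M N) P *:%R quot_lift quot_lift_linear)).
by move=> m n; rewrite /= quot_lift_pi free_liftU.
Qed.

End Def.

Lemma quot_tens_ext (f g : {linear tensor_quot M N -> P}) :
  (forall m n, f (quot_tens m n) = g (quot_tens m n)) -> f =1 g.
Proof.
move=> fg; elim/tensorW=> u; rewrite [u]monalgE.
have uE p : << u@_p *g p >> = u@_p *: << p >> :> F.
  by apply/malgP => q; rewrite mcoeffZ !mcoeffU mulrnAr mulr1.
elim: (enum_fset _) => [|[m n] s IHs].
  by rewrite big_nil pi_tensor0 !linear0.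
by rewrite big_cons uE pi_tensorP !linearP fg IHs.
Qed.

End TensorQuotientLift.

Record tensor_product (K : fieldType) (M N : lmodType K) := TensorProduct {
  tp_space : lmodType K;
  tp_map : M -> N -> tp_space;
  tp_bilinear : bilinear_for ( *:%R) ( *:%R) tp_map;
  tp_lift : forall (P : lmodType K) (f : M -> N -> P),
    bilinear_for ( *:%R) ( *:%R) f ->
    {g : {linear tp_space -> P} | forall m n, g (tp_map m n) = f m n};
  tp_ext : forall (P : lmodType K) (f g : {linear tp_space -> P}),
    (forall m n, f (tp_map m n) = g (tp_map m n)) -> f =1 g
}.

(* Opaque on purpose: only the universal property is used from here on. *)
Lemma tensor_product_exists (K : fieldType) (M N : lmodType K) :
  tensor_product M N.
Proof.
exact: (TensorProduct (@quot_tens_bilinear K M N) (@quot_lift_exists K M N)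
          (@quot_tens_ext K M N)).
Qed.

Section TensorProductTheory.
Context (K : fieldType) (M N : lmodType K).

Definition tensor : lmodType K := tp_space (tensor_product_exists M N).

Definition tens : M -> N -> tensor := @tp_map _ _ _ (tensor_product_exists M N).

Lemma tens_bilinear : bilinear_for ( *:%R) ( *:%R) tens.
Proof. exact: tp_bilinear. Qed.

HB.instance Definition _ :=
  bilinear_isBilinear.Build K M N tensor *:%R *:%R tens tens_bilinear.

Section Lift.
Variables (P : lmodType K) (f : M -> N -> P).
Variable f_bilin : bilinear_for ( *:%R) ( *:%R) f.

Definition tensor_lift : {linear tensor -> P} :=
  sval (tp_lift (tensor_product_exists M N) f_bilin).

Lemma tensor_liftE m n : tensor_lift (tens m n) = f m n.
Proof. exact: (svalP (tp_lift (tensor_product_exists M N) f_bilin)). Qed.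

End Lift.

Lemma tensor_ext (P : lmodType K) (f g : {linear tensor -> P}) :
  (forall m n, f (tens m n) = g (tens m n)) -> f =1 g.
Proof. exact: tp_ext. Qed.

End TensorProductTheory.

Notation "M \otimes N" := (tensor M N) (at level 40, left associativity).
Notation "x \ox y" := (tens x y) : ring_scope.

(* f \ox g for linear maps f and g. *)
Section TensorMap.
Context (K : fieldType) (M M' N N' : lmodType K).
Variables (f : {linear M -> M'}) (g : {linear N -> N'}).

Definition tens_comp (m : M) (n : N) : M' \otimes N' := f m \ox g n.

Fact tens_comp_bilinear : bilinear_for ( *:%R) ( *:%R) tens_comp.
Proof.
split=> [n k m m'|m k n n']; rewrite /= /tens_comp linearP.
  by rewrite linearPl.
by rewrite linearPr.
Qed.

Definition tensor_map : {linear M \otimes N -> M' \otimes N'} :=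
  tensor_lift tens_comp_bilinear.

Lemma tensor_mapE m n : tensor_map (m \ox n) = f m \ox g n.
Proof. exact: tensor_liftE. Qed.

End TensorMap.

Section TensorAssoc.
Context (K : fieldType) (M N P : lmodType K).

Definition tens_assoc (p : P) (m : M) (n : N) : M \otimes (N \otimes P) :=
  m \ox (n \ox p).

Fact tens_assoc_bilinear p : bilinear_for ( *:%R) ( *:%R) (tens_assoc p).
Proof.
split=> [n k m m'|m k n n']; rewrite /= /tens_assoc; first by rewrite linearPl.
by rewrite linearPl linearPr.
Qed.

Definition tensor_assoc_aux (x : M \otimes N) (p : P) : M \otimes (N \otimes P) :=
  tensor_lift (tens_assoc_bilinear p) x.

Fact tensor_assoc_aux_bilinear :
  bilinear_for ( *:%R) ( *:%R) tensor_assoc_aux.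
Proof.
split=> [p k x y|x k p q]; first exact: linearP.
pose h : {linear M \otimes N -> M \otimes (N \otimes P)} :=
  (k \*: tensor_lift (tens_assoc_bilinear p))
    \+ tensor_lift (tens_assoc_bilinear q).
apply: (tensor_ext (g := h)) => m n.
by rewrite /= !tensor_liftE /tens_assoc linearPr linearPr.
Qed.

Definition tensorA : {linear (M \otimes N) \otimes P -> M \otimes (N \otimes P)} :=
  tensor_lift tensor_assoc_aux_bilinear.

Lemma tensorAE m n p : tensorA (m \ox n \ox p) = m \ox (n \ox p).
Proof. by rewrite /tensorA tensor_liftE /tensor_assoc_aux tensor_liftE. Qed.

Definition tens_assocV (m : M) (n : N) (p : P) : (M \otimes N) \otimes P :=
  m \ox n \ox p.

Fact tens_assocV_bilinear m : bilinear_for ( *:%R) ( *:%R) (tens_assocV m).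
Proof.
split=> [n k p q|n k p q]; rewrite /= /tens_assocV; last by rewrite linearPr.
by rewrite linearPr linearPl.
Qed.

Definition tensor_assocV_aux (m : M) (x : N \otimes P) : (M \otimes N) \otimes P :=
  tensor_lift (tens_assocV_bilinear m) x.

Fact tensor_assocV_aux_bilinear :
  bilinear_for ( *:%R) ( *:%R) tensor_assocV_aux.
Proof.
split=> [x k m m'|m k x y]; last exact: linearP.
pose h : {linear N \otimes P -> (M \otimes N) \otimes P} :=
  (k \*: tensor_lift (tens_assocV_bilinear m))
    \+ tensor_lift (tens_assocV_bilinear m').
apply: (tensor_ext (g := h)) => n p.
by rewrite /= !tensor_liftE /tens_assocV linearPl linearPl.
Qed.

Definition tensorAV : {linear M \otimes (N \otimes P) -> (M \otimes N) \otimes P} :=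
  tensor_lift tensor_assocV_aux_bilinear.

Lemma tensorAVE m n p : tensorAV (m \ox (n \ox p)) = m \ox n \ox p.
Proof. by rewrite /tensorAV tensor_liftE /tensor_assocV_aux tensor_liftE. Qed.

End TensorAssoc.

Section Multiplication.
Context (K : fieldType) (A : algType K).

Definition alg_mul (x y : A) : A := x * y.

Fact alg_mul_bilinear : bilinear_for ( *:%R) ( *:%R) alg_mul.
Proof.
split=> [y k x x'|x k y y']; rewrite /= /alg_mul; first by rewrite mulrDl scalerAl.
by rewrite mulrDr scalerAr.
Qed.

Definition tensor_mul : {linear A \otimes A -> A} := tensor_lift alg_mul_bilinear.

Lemma tensor_mulE x y : tensor_mul (x \ox y) = x * y.
Proof. exact: tensor_liftE. Qed.

End Multiplication.

Arguments tensor_mul {K} A.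

Definition twisting_map (K : fieldType) (A B : algType K)
    (chi : {linear A \otimes B -> B \otimes A}) : Prop :=
  [/\ forall b : B, chi (1 \ox b) = b \ox 1,
      forall a : A, chi (a \ox 1) = 1 \ox a,
      chi \o tensor_map (tensor_mul A) (@idfun B)
        =1 tensor_map (@idfun B) (tensor_mul A) \o (@tensorA _ B A A)
             \o tensor_map chi (@idfun A) \o (@tensorAV _ A B A)
             \o tensor_map (@idfun A) chi \o (@tensorA _ A A B)
    & chi \o tensor_map (@idfun A) (tensor_mul B)
        =1 tensor_map (tensor_mul B) (@idfun A) \o (@tensorAV _ B B A)
             \o tensor_map (@idfun B) chi \o (@tensorA _ B A B)
             \o tensor_map chi (@idfun B) \o (@tensorAV _ A B B)].

Section ProductAlgebra.
Context (K : fieldType) (A B C : algType K).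

Definition prod_inl (b : B) : B * C := (b, 0).

Fact prod_inl_linear : linear prod_inl.
Proof. by move=> k u v; congr (_, _); rewrite /= scaler0 addr0. Qed.

HB.instance Definition _ :=
  GRing.isLinear.Build K B (B * C)%type *:%R prod_inl prod_inl_linear.

Definition twist_fst (psi : {linear A \otimes (B * C)%type -> (B * C)%type \otimes A}) :
    {linear A \otimes B -> B \otimes A} :=
  tensor_map (@fst B C) (@idfun A) \o psi \o tensor_map (@idfun A) prod_inl.

Variables (n m : nat) (b : n.-tuple B) (c : m.-tuple C).

Definition prod_basis (i : 'I_(n + m)) : B * C :=
  match split i with
  | inl j => (tnth b j, 0)
  | inr l => (0, tnth c l)
  end.

End ProductAlgebra.

(* [gam i j] is the endomorphism with lower index i and upper index j, and
   [lam i j k] is the coefficient of the k-th basis vector in the product of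
   the i-th and the j-th one; likewise for [eta]. *)
Section Matrices.
Context (K : fieldType) (A : algType K) (n m : nat).
Notation E := {linear A -> A}.
Variables (lam : 'I_n -> 'I_n -> 'I_n -> K) (eta : 'I_m -> 'I_m -> 'I_m -> K).
Variable gam : 'I_(n + m) -> 'I_(n + m) -> E.

Definition mxB2 (k : 'I_n) : 'M[E]_m :=
  \matrix_(p, q) \sum_(l < m) eta q l p *: gam (lshift m k) (rshift n l).

Definition mxC1 (k : 'I_m) : 'M[E]_n :=
  \matrix_(p, q) \sum_(l < n) lam q l p *: gam (rshift n k) (lshift m l).

Definition mxC2 (k : 'I_m) : 'M[E]_m :=
  \matrix_(p, q) \sum_(l < m) eta q l p *: gam (rshift n k) (rshift n l).

Definition mxGamma (a : A) : 'M[A]_(n + m) := \matrix_(i, j) gam j i a.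

Definition Gamma00 (a : A) : 'M[A]_n := ulsubmx (mxGamma a).
Definition Gamma01 (a : A) : 'M[A]_(n, m) := ursubmx (mxGamma a).
Definition Gamma10 (a : A) : 'M[A]_(m, n) := dlsubmx (mxGamma a).
Definition Gamma11 (a : A) : 'M[A]_m := drsubmx (mxGamma a).

(* Scalars of K act entrywise; *: on 'M[E]_m would expect a scalar in E. *)
Definition kscalemx (k : K) (X : 'M[E]_m) : 'M[E]_m := map_mx ( *:%R k) X.

End Matrices.

Notation "k *:K X" := (kscalemx k X) (at level 40) : ring_scope.

(* Main.v *)
Require Import Defs.
From mathcomp Require Import all_boot all_algebra all_field.
Set Implicit Arguments.
Unset Strict Implicit.
Unset Printing Implicit Defensive.
Import GRing.Theory.
Local Open Scope ring_scope.

(** In coordinates, a linear map [chi] with chi(a (x) e_i) = sum_j e_j (x)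
    g_i^j(a) is a twisting map iff the matrix a |-> (g_j^i(a)) is unital and
    multiplicative in a, and the operators g_i^j respect the unit and the
    structure constants of the second factor ([twisting_map_coordP]).  This is
    used twice, for [psi] on D = B * C and for [Theta] on B.

    On D the unit and product conditions are equations in D (x) End(A), so each
    splits into a B-component and a C-component.

    The C-component of the product condition says that the elements
    g_i = sum_l c_l (x) g_i^l of C (x) End(A) multiply according to the
    structure constants of D.  The matrices B_k^(2) and C_k^(2) are the matrices
    of right multiplication by these elements.  Since C is associative and
    unital, passing to right multiplication matrices is multiplicative
    ([rmulmxM]) and injective ([rmulmx_inj]), so no information is lost: the
    C-components become exactly the relations between the matrices B_k^(2) and
    C_k^(2) ([twist_mul_at_rshift], [twist_unit_rshift]).  In the same way the
    vanishing of the matrices C_k^(1) says that g_k^p = 0 for k in the C-part and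
    p in the B-part, which is Gamma^0_1 = 0 ([mxC1_eq0], [Gamma01_eq0]).

    The B-components follow from those of [Theta] as soon as Gamma^0_1 = 0
    ([twist_mul_at_lshift]), and with Gamma^0_1 = 0 the conditions in the
    variable a are block triangular matrix identities whose upper left corner is
    again the condition on [Theta].  What remains is that Gamma^0_1 = 0 when
    [psi] is a twisting map ([lower_triangularP]).  Comparing
    psi(a (x) 1_D) = 1_D (x) a with Theta(a (x) 1_B) = 1_B (x) a shows that
    psi(a (x) (0, 1_C)) has no B-component; writing (0, c) = (0, 1_C)(0, c) and
    projecting the product condition to B, a ring quotient of D, the
    B-component of psi(a (x) (0, c)) is a sum of products each of which has a
    factor from the B-component of psi(a (x) (0, 1_C)), hence zero. *)

(** * Dual bases and tensor products *)

Lemma linend_scalerAl (K : fieldType) (V : lmodType K) (k : K)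
  (f g : {linear V -> V}) : (k *: f) * g = k *: (f * g).
Proof. by apply: linendP. Qed.

Lemma linend_scalerAr (K : fieldType) (V : lmodType K) (k : K)
  (f g : {linear V -> V}) : f * (k *: g) = k *: (f * g).
Proof.
by apply: linendP => x; rewrite linendME !linendZE linendME linearZ.
Qed.

Section DualBases.
Context (K : fieldType) (D : lmodType K) (N : nat).
Implicit Types (e : 'I_N -> D) (f : 'I_N -> {scalar D}).

(** A basis is given together with its coordinate forms, so that the same
    statements serve B with the forms [coord b] and B * C with forms that are
    assembled from those of the factors. *)
Definition dual_bases e f :=
  (forall x, \sum_i f i x *: e i = x)
  /\ (forall i j, f i (e j) = (i == j)%:R).

Section Theory.
Variables (e : 'I_N -> D) (f : 'I_N -> {scalar D}).
Hypothesis ef : dual_bases e f.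

Lemma coord_dual_basis (k : 'I_N -> K) j : f j (\sum_i k i *: e i) = k j.
Proof using ef.
rewrite linear_sum (bigD1 j) //= linearZ /= ef.2 eqxx mulr1 big1 ?addr0 //.
by move=> i ij; rewrite linearZ /= ef.2 eq_sym (negPf ij) mulr0.
Qed.

(** The basis on the left makes D (x) M a direct sum of copies of M: the
    components are read off by the maps induced by d, z |-> f_j(d) z. *)
Lemma tens_coord_inj (M : lmodType K) (x y : 'I_N -> M) :
  \sum_i e i \ox x i = \sum_i e i \ox y i -> x =1 y.
Proof using ef.
move=> exy j.
have bil : bilinear_for ( *:%R) ( *:%R) (fun (d : D) (z : M) => f j d *: z).
  split=> [z k d d'|d k z z'] /=.
    by rewrite linearP /= scalerDl scalerA.
  by rewrite scalerDr !scalerA mulrC.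
have E (z : 'I_N -> M) : tensor_lift bil (\sum_i e i \ox z i) = z j.
  rewrite linear_sum (bigD1 j) //= tensor_liftE ef.2 eqxx scale1r big1 ?addr0 //.
  by move=> i ij; rewrite tensor_liftE ef.2 eq_sym (negPf ij) scale0r.
by rewrite -E exy E.
Qed.

End Theory.
End DualBases.

Section TensorSums.
Context (K : fieldType) (M N P Q : lmodType K).

Lemma tens_suml (I : finType) (x : I -> M) (y : N) :
  (\sum_i x i) \ox y = \sum_i x i \ox y.
Proof. exact: linear_sumlz. Qed.

Lemma tens_sumr (I : finType) (x : M) (y : I -> N) :
  x \ox (\sum_i y i) = \sum_i x \ox y i.
Proof. exact: linear_sumr. Qed.

Lemma tensZl k (x : M) (y : N) : (k *: x) \ox y = k *: (x \ox y).
Proof. exact: linearZl_LR. Qed.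

Lemma tensZr k (x : M) (y : N) : x \ox (k *: y) = k *: (x \ox y).
Proof. exact: linearZr_LR. Qed.

Lemma tensor_ext_assocl (u v : {linear (M \otimes N) \otimes P -> Q}) :
  (forall x y z, u (x \ox y \ox z) = v (x \ox y \ox z)) -> u =1 v.
Proof.
move=> uv; apply: tensor_ext => t z.
by apply: (@tensor_ext _ _ _ _ (u \o applyr (@tens K _ _) z)
                               (v \o applyr (@tens K _ _) z)) => x y /=.
Qed.

Lemma tensor_ext_assocr (u v : {linear M \otimes (N \otimes P) -> Q}) :
  (forall x y z, u (x \ox (y \ox z)) = v (x \ox (y \ox z))) -> u =1 v.
Proof.
move=> uv; apply: tensor_ext => x.
pose tensx : {bilinear M -> N \otimes P -> _ | *:%R & *:%R} := @tens K _ _.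
by apply: (@tensor_ext _ _ _ _ (u \o tensx x) (v \o tensx x)) => y z /=.
Qed.

End TensorSums.

(** * Twisting maps in coordinates *)

Section TwistingCoordinates.
Context (K : fieldType) (A D : algType K) (N : nat).
Variables (e : 'I_N -> D) (f : 'I_N -> {scalar D}).
Hypothesis ef : dual_bases e f.
Variables (chi : {linear A \otimes D -> D \otimes A}).
Variable g : 'I_N -> 'I_N -> {linear A -> A}.
Hypothesis gE : forall a i, chi (a \ox e i) = \sum_j e j \ox g i j a.

(** The upper index is the row, so that multiplicativity in the first factor is
    compatibility with the usual matrix product. *)
Definition coord_mx (a : A) : 'M[A]_N := \matrix_(i, j) g j i a.

Lemma tens_coordE (d : D) (a : A) : d \ox a = \sum_p e p \ox (f p d *: a).
Proof using ef.
rewrite -{1}(ef.1 d) tens_suml; apply: eq_bigr => p _.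
by rewrite tensZl tensZr.
Qed.

Lemma twist_coordE (a : A) (d : D) :
  chi (a \ox d) = \sum_p e p \ox (\sum_i f i d *: g i p) a.
Proof using ef gE.
rewrite -{1}(ef.1 d) tens_sumr linear_sum /=.
transitivity (\sum_i \sum_p e p \ox (f i d *: g i p a)).
  apply: eq_bigr => i _; rewrite tensZr linearZ /= gE scaler_sumr.
  by apply: eq_bigr => p _; rewrite tensZr.
rewrite exchange_big; apply: eq_bigr => p _ /=.
by rewrite -tens_sumr linend_sumE.
Qed.

Lemma twist_mull_coordE (a a' : A) i :
  (tensor_map (@idfun D) (tensor_mul A) \o (@tensorA _ D A A)
     \o tensor_map chi (@idfun A) \o (@tensorAV _ A D A)
     \o tensor_map (@idfun A) chi \o (@tensorA _ A A D)) (a \ox a' \ox e i)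
  = \sum_k e k \ox (coord_mx a *m coord_mx a') k i.
Proof using gE.
rewrite /= tensorAE tensor_mapE /= gE tens_sumr !linear_sum /=.
transitivity (\sum_j \sum_k e k \ox (g j k a * g i j a')).
  apply: eq_bigr => j _.
  rewrite tensorAVE tensor_mapE /= gE tens_suml !linear_sum /=.
  by apply: eq_bigr => k _; rewrite tensorAE tensor_mapE /= tensor_mulE.
rewrite exchange_big; apply: eq_bigr => k _ /=.
rewrite -tens_sumr mxE; congr (_ \ox _).
by apply: eq_bigr => j _; rewrite !mxE.
Qed.

Lemma twist_mulr_coordE (a : A) i j :
  (tensor_map (tensor_mul D) (@idfun A) \o (@tensorAV _ D D A)
     \o tensor_map (@idfun D) chi \o (@tensorA _ D A D)
     \o tensor_map chi (@idfun D) \o (@tensorAV _ A D D)) (a \ox (e i \ox e j))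
  = \sum_p e p \ox
      (\sum_k \sum_l f p (e k * e l) *: (g j l * g i k)) a.
Proof using ef gE.
rewrite /= tensorAVE tensor_mapE /= gE tens_suml !linear_sum /=.
transitivity (\sum_k \sum_l \sum_p e p \ox
                 (f p (e k * e l) *: g j l (g i k a))).
  apply: eq_bigr => k _.
  rewrite tensorAE tensor_mapE /= gE tens_sumr !linear_sum /=.
  apply: eq_bigr => l _; rewrite tensorAVE tensor_mapE /= tensor_mulE.
  exact: tens_coordE.
transitivity (\sum_k \sum_p \sum_l e p \ox
                (f p (e k * e l) *: g j l (g i k a))).
  by apply: eq_bigr => k _; rewrite exchange_big.
rewrite exchange_big; apply: eq_bigr => p _ /=.
rewrite linend_sumE tens_sumr; apply: eq_bigr => k _.
by rewrite linend_sumE tens_sumr; apply: eq_bigr => l _.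
Qed.

(** Both sides of each axiom are expanded on pure tensors of basis vectors of D;
    components are compared with [tens_coord_inj], and in the other direction
    linearity extends the equations from basis vectors to all tensors. *)
Lemma twisting_map_coordP :
  twisting_map chi <->
  [/\ coord_mx 1 = 1%:M,
      forall p, \sum_i f i 1 *: g i p = f p 1 *: (1 : {linear A -> A}),
      forall a a', coord_mx (a * a') = coord_mx a *m coord_mx a'
    & forall i j p, \sum_k f k (e i * e j) *: g k p
        = \sum_k \sum_l f p (e k * e l) *: (g j l * g i k)].
Proof using ef gE.
have gmxE a i : chi (a \ox e i) = \sum_k e k \ox coord_mx a k i.
  by rewrite gE; apply: eq_bigr => j _; rewrite mxE.
have delta i : e i \ox (1 : A) = \sum_k e k \ox (1%:M : 'M[A]_N) k i.
  rewrite (tens_coordE (e i)); apply: eq_bigr => k _.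
  by rewrite ef.2 !mxE scaler_nat.
split=> [[chi1l chi1r chiMl chiMr] | [g1 gu gM gD]].
  split=> [|p|a a'|i j p].
  - apply/matrixP => k i.
    apply: (tens_coord_inj ef (x := coord_mx 1 ^~ i)
              (y := (1%:M : 'M[A]_N) ^~ i)).
    by rewrite -gmxE chi1l delta.
  - apply: linendP => a; rewrite linendZE linend1E; move: p.
    apply: (tens_coord_inj ef (y := fun p => f p 1 *: a)).
    by rewrite -twist_coordE chi1r -tens_coordE.
  - apply/matrixP => k i.
    apply: (tens_coord_inj ef (x := coord_mx (a * a') ^~ i)
              (y := (coord_mx a *m coord_mx a') ^~ i)).
    rewrite -gmxE -twist_mull_coordE -chiMl /=.
    by rewrite tensor_mapE /= tensor_mulE.
  - apply: linendP => a; move: p; apply: (tens_coord_inj ef).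
    rewrite -twist_coordE -twist_mulr_coordE -chiMr /=.
    by rewrite tensor_mapE /= tensor_mulE.
split.
- move=> d; rewrite -(ef.1 d) tens_sumr tens_suml linear_sum.
  apply: eq_bigr => i _.
  by rewrite tensZr linearZ /= gmxE g1 -delta tensZl.
- move=> a; rewrite twist_coordE (tens_coordE 1).
  by apply: eq_bigr => p _; rewrite gu.
- apply: tensor_ext_assocl => a a' d.
  rewrite -(ef.1 d) tens_sumr 2!linear_sum; apply: eq_bigr => i _.
  rewrite tensZr 2!linearZ; congr (_ *: _).
  apply: etrans (esym (twist_mull_coordE _ _ _)); rewrite -gM -gmxE.
  by rewrite /= tensor_mapE /= tensor_mulE.
- apply: tensor_ext_assocr => a d d'.
  rewrite -(ef.1 d) tens_suml tens_sumr 2!linear_sum; apply: eq_bigr => i _.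
  rewrite -(ef.1 d') tens_sumr tens_sumr 2!linear_sum; apply: eq_bigr => j _.
  rewrite tensZl !tensZr 4!linearZ; do 2 congr (_ *: _).
  apply: etrans (esym (twist_mulr_coordE _ _ _)).
  rewrite /= tensor_mapE /= tensor_mulE twist_coordE.
  by apply: eq_bigr => p _; rewrite gD.
Qed.

End TwistingCoordinates.

(** * Matrices of right multiplication *)

Section RightMultiplication.
Context (K : fieldType) (A C : algType K) (m : nat).
Notation E := {linear A -> A}.
Variables (e : 'I_m -> C) (f : 'I_m -> {scalar C}).
Hypothesis ef : dual_bases e f.
Variable eta : 'I_m -> 'I_m -> 'I_m -> K.
Hypothesis etaE : forall i j, e i * e j = \sum_k eta i j k *: e k.

(** The matrix, on the basis [e], of right multiplication by the element
    sum_l e_l (x) X_l of C (x) End(A). *)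
Definition rmulmx (X : 'I_m -> E) : 'M[E]_m :=
  \matrix_(p, q) \sum_l eta q l p *: X l.

Lemma struct_constE i j k : eta i j k = f k (e i * e j).
Proof using ef etaE. by rewrite etaE (coord_dual_basis ef). Qed.

(** The coefficient of e_p in (e_q e_s) e_l = e_q (e_s e_l). *)
Lemma struct_const_assoc q s l p :
  \sum_r eta q s r * eta r l p = \sum_t eta s l t * eta q t p.
Proof using ef etaE.
transitivity (f p (e q * e s * e l)).
  rewrite etaE mulr_suml linear_sum; apply: eq_bigr => r _.
  by rewrite -scalerAl linearZ /= (struct_constE r).
rewrite -mulrA (etaE s) mulr_sumr linear_sum; apply: eq_bigr => t _.
by rewrite -scalerAr linearZ /= (struct_constE q).
Qed.

Lemma struct_const_unitl l p : \sum_q f q 1 * eta q l p = (p == l)%:R.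
Proof using ef etaE.
rewrite -ef.2 -[e l]mul1r -{2}(ef.1 1) mulr_suml linear_sum.
by apply: eq_bigr => q _; rewrite -scalerAl linearZ /= struct_constE.
Qed.

Lemma struct_const_unitr q p : \sum_l eta q l p * f l 1 = (p == q)%:R.
Proof using ef etaE.
rewrite -ef.2 -[e q]mulr1 -{2}(ef.1 1) mulr_sumr linear_sum.
by apply: eq_bigr => l _; rewrite -scalerAr linearZ /= struct_constE mulrC.
Qed.

(** An element is recovered from its right multiplication by applying it to the
    unit of C. *)
Lemma rmulmxK (X : 'I_m -> E) p : \sum_q f q 1 *: rmulmx X p q = X p.
Proof using ef etaE.
transitivity (\sum_l (\sum_q f q 1 * eta q l p) *: X l).
  under [RHS]eq_bigr do rewrite scaler_suml.
  rewrite exchange_big; apply: eq_bigr => q _ /=.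
  by rewrite mxE scaler_sumr; apply: eq_bigr => l _; rewrite scalerA.
rewrite (bigD1 p) //= struct_const_unitl eqxx scale1r big1 ?addr0 // => l lp.
by rewrite struct_const_unitl eq_sym (negPf lp) scale0r.
Qed.

Lemma rmulmx_inj (X Y : 'I_m -> E) : rmulmx X = rmulmx Y -> X =1 Y.
Proof using ef etaE. by move=> XY p; rewrite -rmulmxK XY rmulmxK. Qed.

Lemma eq_rmulmx (X Y : 'I_m -> E) : X =1 Y -> rmulmx X = rmulmx Y.
Proof.
by move=> XY; apply/matrixP => p q; rewrite !mxE; apply: eq_bigr => l _; rewrite XY.
Qed.

Lemma rmulmx0 : rmulmx (fun=> 0) = 0.
Proof.
by apply/matrixP => p q; rewrite !mxE big1 // => l _; rewrite scaler0.
Qed.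

Lemma rmulmx1 : rmulmx (fun l => f l 1 *: (1 : E)) = 1%:M.
Proof using ef etaE.
apply/matrixP => p q; rewrite !mxE.
under eq_bigr do rewrite scalerA.
by rewrite -scaler_suml struct_const_unitr; case: eqP => _;
  rewrite ?scale1r ?scale0r.
Qed.

Lemma rmulmxD (X Y : 'I_m -> E) :
  rmulmx (fun l => X l + Y l) = rmulmx X + rmulmx Y.
Proof.
apply/matrixP => p q; rewrite !mxE -big_split; apply: eq_bigr => l _ /=.
exact: scalerDr.
Qed.

Lemma rmulmx_sum (I : finType) (k : I -> K) (X : I -> 'I_m -> E) :
  rmulmx (fun l => \sum_i k i *: X i l) = \sum_i k i *:K rmulmx (X i).
Proof.
apply/matrixP => p q; rewrite summxE !mxE.
under eq_bigr do rewrite scaler_sumr.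
rewrite exchange_big; apply: eq_bigr => i _ /=.
rewrite !mxE scaler_sumr; apply: eq_bigr => l _.
by rewrite !scalerA mulrC.
Qed.

(** Right multiplication reverses products in C, while the operators in End(A)
    are composed in the order X after Y; hence the convolution pairs the left
    index s with Y and the right index l with X. *)
Lemma rmulmxM (X Y : 'I_m -> E) :
  rmulmx (fun t => \sum_s \sum_l eta s l t *: (X l * Y s))
  = rmulmx X *m rmulmx Y.
Proof using ef etaE.
apply/matrixP => p q; rewrite !mxE.
transitivity (\sum_s \sum_l (\sum_t eta s l t * eta q t p) *: (X l * Y s)).
  under eq_bigr do rewrite scaler_sumr.
  rewrite exchange_big; apply: eq_bigr => s _ /=.
  under eq_bigr do rewrite scaler_sumr.
  rewrite exchange_big; apply: eq_bigr => l _ /=.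
  by rewrite scaler_suml; apply: eq_bigr => t _; rewrite scalerA mulrC.
transitivity (\sum_s \sum_l \sum_r
                (eta r l p *: X l) * (eta q s r *: Y s)).
  apply: eq_bigr => s _; apply: eq_bigr => l _.
  rewrite -struct_const_assoc scaler_suml; apply: eq_bigr => r _.
  by rewrite linend_scalerAl linend_scalerAr scalerA mulrC.
under eq_bigr do rewrite exchange_big.
rewrite exchange_big; apply: eq_bigr => r _ /=.
rewrite !mxE mulr_sumr; apply: eq_bigr => s _.
by rewrite mulr_suml.
Qed.

Lemma rmulmxM_eq (X Y Z : 'I_m -> E) :
  (forall t, Z t = \sum_s \sum_l eta s l t *: (X l * Y s)) <->
  rmulmx X *m rmulmx Y = rmulmx Z.
Proof using ef etaE.
rewrite -rmulmxM; split=> [XYZ | /rmulmx_inj XYZ t]; last by rewrite -XYZ.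
exact/esym/eq_rmulmx.
Qed.

End RightMultiplication.

(** * The basis of the product algebra *)

Lemma coord_dual_bases (K : fieldType) (V : vectType K) (n : nat)
  (b : n.-tuple V) : basis_of {:V} b -> dual_bases (tnth b) (coord b).
Proof.
move=> b_basis; split=> [x | i j].
  rewrite [RHS](coord_basis b_basis (memvf x)); apply: eq_bigr => i _.
  by rewrite (tnth_nth 0).
rewrite (tnth_nth 0) eq_sym.
exact: (coord_free j i (basis_free b_basis)).
Qed.

Lemma split_lshift (n m : nat) (i : 'I_n) : split (lshift m i) = inl i.
Proof. exact: (unsplitK (inl _ i)). Qed.

Lemma split_rshift (n m : nat) (i : 'I_m) : split (rshift n i) = inr i.
Proof. exact: (unsplitK (inr _ i)). Qed.

Definition splitE := (split_lshift, split_rshift).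

Section ProductBasis.
Context (K : fieldType) (B C : algType K) (n m : nat).
Variables (b : n.-tuple B) (c : m.-tuple C).
Variables (fB : 'I_n -> {scalar B}) (fC : 'I_m -> {scalar C}).
Hypotheses (bB : dual_bases (tnth b) fB) (cC : dual_bases (tnth c) fC).
Notation d := (prod_basis b c).

Definition prod_dual (i : 'I_(n + m)) : {scalar (B * C)%type} :=
  match split i with
  | inl j => fB j \o fst
  | inr l => fC l \o snd
  end.
Notation f := prod_dual.

Lemma prod_basisl i : d (lshift m i) = (tnth b i, 0).
Proof. by rewrite /prod_basis splitE. Qed.

Lemma prod_basisr i : d (rshift n i) = (0, tnth c i).
Proof. by rewrite /prod_basis splitE. Qed.

Lemma prod_duall i x : f (lshift m i) x = fB i x.1.
Proof. by rewrite /prod_dual splitE. Qed.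

Lemma prod_dualr i x : f (rshift n i) x = fC i x.2.
Proof. by rewrite /prod_dual splitE. Qed.

Lemma prod_dual_bases : dual_bases d f.
Proof using bB cC.
split=> [[x y] | i j].
  rewrite big_split_ord /=.
  have -> : \sum_i f (lshift m i) (x, y) *: d (lshift m i) = (x, 0).
    rewrite -[x in RHS](bB.1 x) -[RHS]/(@prod_inl K B C _) linear_sum.
    apply: eq_bigr => i _.
    by rewrite prod_duall prod_basisl linearZ.
  have -> : \sum_i f (rshift n i) (x, y) *: d (rshift n i) = (0, y).
    transitivity (\sum_i ((0, fC i y *: tnth c i) : B * C)).
      apply: eq_bigr => i _; rewrite prod_dualr prod_basisr.
      by congr (_, _); rewrite /= scaler0.
    rewrite -[y in RHS](cC.1 y).
    by elim/big_ind2: _ => // u v u' v' -> ->; congr (_, _); rewrite addr0.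
  by congr (_, _); rewrite /= ?addr0 ?add0r.
case: (split_ordP i) => k ->; case: (split_ordP j) => l ->.
- by rewrite prod_basisl prod_duall bB.2 eq_lshift.
- by rewrite prod_basisr prod_duall linear0 eq_lrshift.
- by rewrite prod_basisl prod_dualr linear0 eq_rlshift.
- by rewrite prod_basisr prod_dualr cC.2 eq_rshift.
Qed.

Variables (lam : 'I_n -> 'I_n -> 'I_n -> K) (eta : 'I_m -> 'I_m -> 'I_m -> K).
Hypothesis lamE : forall i j,
  tnth b i * tnth b j = \sum_k lam i j k *: tnth b k.
Hypothesis etaE : forall i j,
  tnth c i * tnth c j = \sum_k eta i j k *: tnth c k.

Lemma prod_dual_mul i j k : f k (d i * d j) =
  match split i, split j, split k with
  | inl i, inl j, inl k => lam i j k
  | inr i, inr j, inr k => eta i j k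
  | _, _, _ => 0
  end.
Proof using bB cC lamE etaE.
rewrite /prod_dual /prod_basis.
case: (split k) => k'; case: (split i) => i'; case: (split j) => j' /=;
  rewrite ?mulr0 ?mul0r ?linear0 //.
  by rewrite (struct_constE bB lamE).
by rewrite (struct_constE cC etaE).
Qed.

Lemma prod_dual_sum_mul (V : lmodType K) (G : 'I_(n + m) -> V) i j :
  \sum_k f k (d i * d j) *: G k =
  match split i, split j with
  | inl i, inl j => \sum_k lam i j k *: G (lshift m k)
  | inr i, inr j => \sum_k eta i j k *: G (rshift n k)
  | _, _ => 0
  end.
Proof using bB cC lamE etaE.
rewrite big_split_ord /=.
under eq_bigr do rewrite prod_dual_mul splitE.
under [X in _ + X]eq_bigr do rewrite prod_dual_mul splitE.
have sum0 (I : finType) (v : I -> V) : \sum_i 0 *: v i = 0.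
  by rewrite big1 // => k _; rewrite scale0r.
by case: (split i) => i'; case: (split j) => j';
  rewrite !sum0 ?addr0 ?add0r.
Qed.

Lemma prod_dual_sum_coord (V : lmodType K)
    (G : 'I_(n + m) -> 'I_(n + m) -> V) p :
  \sum_i \sum_j f p (d i * d j) *: G i j =
  match split p with
  | inl p => \sum_i \sum_j lam i j p *: G (lshift m i) (lshift m j)
  | inr p => \sum_i \sum_j eta i j p *: G (rshift n i) (rshift n j)
  end.
Proof using bB cC lamE etaE.
have split_sum (F : 'I_(n + m) -> 'I_(n + m) -> V) :
    \sum_i \sum_j F i j =
    \sum_i (\sum_j F (lshift m i) (lshift m j)
            + \sum_j F (lshift m i) (rshift n j))
    + \sum_i (\sum_j F (rshift n i) (lshift m j)
              + \sum_j F (rshift n i) (rshift n j)).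
  by rewrite big_split_ord; congr (_ + _); apply: eq_bigr => i _;
    rewrite big_split_ord.
rewrite split_sum.
case: (split_ordP p) => q ->.
  rewrite [X in _ + X]big1 ?addr0 => [|i _]; last first.
    by rewrite !big1 ?addr0 // => j _; rewrite prod_dual_mul !splitE scale0r.
  apply: eq_bigr => i _; rewrite [X in _ + X]big1 ?addr0 => [|j _].
    by apply: eq_bigr => j _; rewrite prod_dual_mul !splitE.
  by rewrite prod_dual_mul !splitE scale0r.
rewrite [X in X + _]big1 ?add0r => [|i _]; last first.
  by rewrite !big1 ?addr0 // => j _; rewrite prod_dual_mul !splitE scale0r.
apply: eq_bigr => i _; rewrite [X in X + _]big1 ?add0r => [|j _].
  by apply: eq_bigr => j _; rewrite prod_dual_mul !splitE.
by rewrite prod_dual_mul !splitE scale0r.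
Qed.

End ProductBasis.

(** * Block conditions for a twisting map on a product *)

Section ProductTwisting.
Context (K : fieldType) (A B C : algType K) (n m : nat).
Notation E := {linear A -> A}.
Variables (b : n.-tuple B) (c : m.-tuple C).
Variables (fB : 'I_n -> {scalar B}) (fC : 'I_m -> {scalar C}).
Hypotheses (bB : dual_bases (tnth b) fB) (cC : dual_bases (tnth c) fC).
Notation d := (prod_basis b c).
Notation f := (prod_dual fB fC).
Variables (lam : 'I_n -> 'I_n -> 'I_n -> K) (eta : 'I_m -> 'I_m -> 'I_m -> K).
Hypothesis lamE : forall i j,
  tnth b i * tnth b j = \sum_k lam i j k *: tnth b k.
Hypothesis etaE : forall i j,
  tnth c i * tnth c j = \sum_k eta i j k *: tnth c k.
Variable g : 'I_(n + m) -> 'I_(n + m) -> E.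

Definition gB (i j : 'I_n) : E := g (lshift m i) (lshift m j).

Lemma twist_fst_coordE
    (psi : {linear A \otimes (B * C)%type -> (B * C)%type \otimes A})
    (gE : forall a i, psi (a \ox d i) = \sum_j d j \ox g i j a) a i :
  twist_fst psi (a \ox tnth b i) = \sum_j tnth b j \ox gB i j a.
Proof.
rewrite /= tensor_mapE /= -[prod_inl C _](prod_basisl b c) gE linear_sum /=.
rewrite big_split_ord /= [X in _ + X]big1 ?addr0 => [|j _].
  by apply: eq_bigr => j _; rewrite tensor_mapE prod_basisl.
by rewrite tensor_mapE prod_basisr linear0l.
Qed.

(** With the upper index as row, these are the entries of the upper right block
    of [coord_mx g]. *)
Definition lower_triangular := forall k p, g (rshift n k) (lshift m p) = 0.

Lemma Gamma01_eq0 : lower_triangular <-> forall a, Gamma01 g a = 0.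
Proof.
split=> [g0 a | G0 k p].
  by apply/matrixP => p k; rewrite !mxE g0.
by apply: linendP => a; have /matrixP/(_ p k) := G0 a; rewrite !mxE.
Qed.

Lemma mxC1_eq0 : lower_triangular <-> forall k, mxC1 lam g k = 0.
Proof using bB lamE.
split=> [g0 k | C0 k p].
  by rewrite -(rmulmx0 A lam); apply: eq_rmulmx => p; rewrite g0.
by move: p; apply: (rmulmx_inj bB lamE); rewrite rmulmx0 -[RHS](C0 k).
Qed.

Definition twist_mul_at i j p :=
  \sum_k f k (d i * d j) *: g k p
  = \sum_k \sum_l f p (d k * d l) *: (g j l * g i k).

(** By comparing unit conditions, the B-components of psi(a (x) (0, 1_C))
    vanish; since (0, c_k) = (0, 1_C) (0, c_k), the product condition propagates
    this to every c_k. *)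
Lemma lower_triangularP :
  (forall p, \sum_i fB i 1 *: gB i p = fB p 1 *: (1 : E)) ->
  (forall p, \sum_i f i 1 *: g i p = f p 1 *: (1 : E)) ->
  (forall i j p, twist_mul_at i j p) -> lower_triangular.
Proof using bB cC lamE etaE.
move=> uB uD gM k p.
have u0 q : \sum_j fC j 1 *: g (rshift n j) (lshift m q) = 0.
  apply: (addrI (fB q 1 *: (1 : E))); rewrite addr0 -{1}uB.
  have := uD (lshift m q); rewrite big_split_ord /= prod_duall => <-.
  by congr (_ + _); apply: eq_bigr => i _; rewrite ?prod_duall ?prod_dualr.
(* Replace c_k by 1_C c_k, with 1_C expanded on the basis c. *)
transitivity (\sum_j fC j 1 *: \sum_t f t (d (rshift n j) * d (rshift n k))
                                 *: g t (lshift m p)).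
  under eq_bigr do rewrite scaler_sumr.
  rewrite exchange_big /=.
  transitivity (\sum_t f t (d (rshift n k)) *: g t (lshift m p)).
    rewrite (bigD1 (rshift n k)) //= (prod_dual_bases bB cC).2 eqxx scale1r.
    rewrite big1 ?addr0 // => t tk.
    by rewrite (prod_dual_bases bB cC).2 (negPf tk) scale0r.
  apply: eq_bigr => t _; under eq_bigr do rewrite scalerA.
  rewrite -scaler_suml; congr (_ *: _).
  case: (split_ordP t) => s ->.
    rewrite prod_duall prod_basisr linear0 big1 // => j _.
    by rewrite prod_duall !prod_basisr /= mulr0 linear0 mulr0.
  rewrite prod_dualr prod_basisr /= -[tnth c k in LHS]mul1r -(cC.1 1) mulr_suml.
  rewrite linear_sum; apply: eq_bigr => j _.
  by rewrite prod_dualr !prod_basisr -scalerAl linearZ /= cC.1.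
(* Only the B-indices s, t survive in a B-component of a product. *)
under eq_bigr do rewrite gM (prod_dual_sum_coord bB cC lamE etaE) splitE.
under eq_bigr do rewrite scaler_sumr.
rewrite exchange_big big1 // => s _ /=.
under eq_bigr do rewrite scaler_sumr.
rewrite exchange_big big1 // => t _ /=.
transitivity (lam s t p *: (g (rshift n k) (lshift m t)
                 * \sum_j fC j 1 *: g (rshift n j) (lshift m s))).
  rewrite mulr_sumr scaler_sumr; apply: eq_bigr => j _.
  by rewrite linend_scalerAr !scalerA mulrC.
by rewrite u0 mulr0 scaler0.
Qed.

(** For fixed i and j, both sides are the components of an element of
    C (x) End(A); taking matrices of right multiplication turns the equation
    into M_j M_i = sum_k f_k(d_i d_j) M_k, and the four relations are the four
    choices of blocks for i and j. *)
Lemma twist_mul_at_rshift :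
  (forall i j q, twist_mul_at i j (rshift n q)) <->
  [/\ forall i j, mxB2 eta g i *m mxB2 eta g j
        = \sum_k lam j i k *:K mxB2 eta g k,
      forall i j, mxC2 eta g i *m mxC2 eta g j
        = \sum_k eta j i k *:K mxC2 eta g k
    & forall i j, mxB2 eta g i *m mxC2 eta g j = 0
        /\ mxC2 eta g j *m mxB2 eta g i = 0].
Proof using bB cC lamE etaE.
pose Z i j q := \sum_k f k (d i * d j) *: g k (rshift n q).
pose M k := rmulmx eta (fun q => g k (rshift n q)).
have mulP i j : (forall q, twist_mul_at i j (rshift n q)) <->
    M j *m M i = rmulmx eta (Z i j).
  rewrite -(rmulmxM_eq cC etaE).
  by split=> Zij q; have := Zij q;
     rewrite /twist_mul_at (prod_dual_sum_coord bB cC lamE etaE) splitE.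
have ZE i j : Z i j =1 fun q => match split i, split j with
    | inl i, inl j => \sum_k lam i j k *: g (lshift m k) (rshift n q)
    | inr i, inr j => \sum_k eta i j k *: g (rshift n k) (rshift n q)
    | _, _ => 0
    end.
  by move=> q; rewrite /Z (prod_dual_sum_mul bB cC lamE etaE).
have Zll i j : rmulmx eta (Z (lshift m i) (lshift m j))
    = \sum_k lam i j k *:K mxB2 eta g k.
  by rewrite (eq_rmulmx eta (ZE _ _)) !splitE rmulmx_sum.
have Zrr i j : rmulmx eta (Z (rshift n i) (rshift n j))
    = \sum_k eta i j k *:K mxC2 eta g k.
  by rewrite (eq_rmulmx eta (ZE _ _)) !splitE rmulmx_sum.
have Zlr i j : rmulmx eta (Z (lshift m i) (rshift n j)) = 0.
  by rewrite (eq_rmulmx eta (ZE _ _)) !splitE rmulmx0.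
have Zrl i j : rmulmx eta (Z (rshift n i) (lshift m j)) = 0.
  by rewrite (eq_rmulmx eta (ZE _ _)) !splitE rmulmx0.
split=> [gM | [BB CC BC] i j].
  have {}mulP i j : M j *m M i = rmulmx eta (Z i j) by apply/mulP/gM.
  split=> [i j|i j|i j].
  - by rewrite -Zll -mulP.
  - by rewrite -Zrr -mulP.
  - by split; [rewrite -(Zrl j i) -mulP | rewrite -(Zlr i j) -mulP].
apply/mulP; case: (split_ordP i) => i' ->; case: (split_ordP j) => j' ->.
- by rewrite Zll -BB.
- by rewrite Zlr; apply: (BC i' j').2.
- by rewrite Zrl; apply: (BC j' i').1.
- by rewrite Zrr -CC.
Qed.

(** When i or j lies in the C-part, triangularity puts a zero factor in each
    term on the right, and the left-hand side only involves g_k^p with k in the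
    C-part. *)
Lemma twist_mul_at_lshift : lower_triangular ->
  (forall i j p, \sum_k fB k (tnth b i * tnth b j) *: gB k p
     = \sum_k \sum_l fB p (tnth b k * tnth b l) *: (gB j l * gB i k)) ->
  forall i j p, twist_mul_at i j (lshift m p).
Proof using bB cC lamE etaE.
move=> g0 gM i j p; rewrite /twist_mul_at.
rewrite (prod_dual_sum_coord bB cC lamE etaE) (prod_dual_sum_mul bB cC lamE etaE).
case: (split_ordP i) => i' ->; case: (split_ordP j) => j' ->; rewrite !splitE.
- have := gM i' j' p; under eq_bigr do rewrite -(struct_constE bB lamE).
  move=> ->; apply: eq_bigr => k _; apply: eq_bigr => l _.
  by rewrite (struct_constE bB lamE).
- rewrite big1 // => k _; rewrite big1 // => l _.
  by rewrite g0 mul0r scaler0.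
- rewrite big1 // => k _; rewrite big1 // => l _.
  by rewrite g0 mulr0 scaler0.
- rewrite !big1 // => k _; first by rewrite big1 // => l _; rewrite g0 mul0r scaler0.
  by rewrite g0 scaler0.
Qed.

Lemma twist_unit_rshift :
  (forall q, \sum_i f i 1 *: g i (rshift n q) = f (rshift n q) 1 *: (1 : E)) <->
  \sum_i fB i 1 *:K mxB2 eta g i + \sum_j fC j 1 *:K mxC2 eta g j = 1%:M.
Proof using cC etaE.
rewrite -(rmulmx1 A cC etaE).
have -> : \sum_i fB i 1 *:K mxB2 eta g i + \sum_j fC j 1 *:K mxC2 eta g j
    = rmulmx eta (fun q => \sum_i f i 1 *: g i (rshift n q)).
  rewrite -!rmulmx_sum -rmulmxD; apply: eq_rmulmx => q; rewrite big_split_ord /=.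
  by congr (_ + _); apply: eq_bigr => i _; rewrite ?prod_duall ?prod_dualr.
split=> [uD | /(rmulmx_inj cC etaE) uD q].
  by apply: eq_rmulmx => q; rewrite uD prod_dualr.
by rewrite uD prod_dualr.
Qed.

Lemma Gamma00E a : Gamma00 g a = coord_mx gB a.
Proof. by apply/matrixP => i j; rewrite !mxE. Qed.

Lemma coord_mx_block a : lower_triangular ->
  coord_mx g a = block_mx (coord_mx gB a) 0 (Gamma10 g a) (Gamma11 g a).
Proof.
move=> /Gamma01_eq0 G0; rewrite -[LHS]submxK -Gamma00E.
by congr (block_mx _ _ _ _); exact: G0.
Qed.

End ProductTwisting.

Theorem proposition3p5 (K : fieldType) (A : algType K) (B C : falgType K)
    (n m : nat) (b : n.-tuple B) (c : m.-tuple C)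
    (b_basis : basis_of {:B} b) (c_basis : basis_of {:C} c)
    (lam : 'I_n -> 'I_n -> 'I_n -> K)
    (lamE : forall i j : 'I_n,
       tnth b i * tnth b j = \sum_(k < n) lam i j k *: tnth b k)
    (eta : 'I_m -> 'I_m -> 'I_m -> K)
    (etaE : forall i j : 'I_m,
       tnth c i * tnth c j = \sum_(k < m) eta i j k *: tnth c k)
    (alpha : 'I_n -> K) (beta : 'I_m -> K)
    (alpha_betaE : (1 : B * C) =
       \sum_(k < n) alpha k *: prod_basis b c (lshift m k)
       + \sum_(l < m) beta l *: prod_basis b c (rshift n l))
    (psi : {linear A \otimes (B * C)%type -> (B * C)%type \otimes A})
    (gam : 'I_(n + m) -> 'I_(n + m) -> {linear A -> A})
    (gamE : forall (a : A) (i : 'I_(n + m)),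
       psi (a \ox prod_basis b c i)
       = \sum_(j < n + m) prod_basis b c j \ox gam i j a)
    (Theta_twisting : twisting_map (twist_fst psi)) :
  twisting_map psi <->
    (forall i j : 'I_n,
       mxB2 eta gam i *m mxB2 eta gam j
       = \sum_(k < n) lam j i k *:K mxB2 eta gam k)
    /\ (forall j : 'I_m, mxC1 lam gam j = 0)
    /\ (forall i j : 'I_m,
       mxC2 eta gam i *m mxC2 eta gam j
       = \sum_(k < m) eta j i k *:K mxC2 eta gam k)
    /\ (forall (i : 'I_n) (j : 'I_m),
       mxB2 eta gam i *m mxC2 eta gam j = 0
       /\ mxC2 eta gam j *m mxB2 eta gam i = 0)
    /\ \sum_(i < n) alpha i *:K mxB2 eta gam i
       + \sum_(j < m) beta j *:K mxC2 eta gam j = 1%:M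
    /\ (forall a : A, Gamma01 gam a = 0)
    /\ (forall a a' : A, Gamma11 gam (a * a') = Gamma11 gam a *m Gamma11 gam a')
    /\ (forall a a' : A,
       Gamma10 gam (a * a')
       = Gamma10 gam a *m Gamma00 gam a' + Gamma11 gam a *m Gamma10 gam a')
    /\ Gamma11 gam 1 = 1%:M
    /\ Gamma10 gam 1 = 0.
Proof.
have bB := coord_dual_bases b_basis.
have cC := coord_dual_bases c_basis.
have dD := prod_dual_bases bB cC.
pose ab (i : 'I_(n + m)) :=
  match split i with inl k => alpha k | inr l => beta l end.
have abE i : prod_dual (coord b) (coord c) i 1 = ab i.
  rewrite alpha_betaE -(coord_dual_basis dD ab) big_split_ord /=.
  by congr (prod_dual _ _ _ (_ + _)); apply: eq_bigr => k _; rewrite /ab splitE.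
have alphaE k : alpha k = coord b k 1.
  by have := abE (lshift m k); rewrite prod_duall /ab splitE.
have betaE l : beta l = coord c l 1.
  by have := abE (rshift n l); rewrite prod_dualr /ab splitE.
have [gB1 gBu gBM gBD] :=
  (twisting_map_coordP bB (twist_fst_coordE gamE)).1 Theta_twisting.
have unitE : \sum_i alpha i *:K mxB2 eta gam i + \sum_j beta j *:K mxC2 eta gam j
    = \sum_i coord b i 1 *:K mxB2 eta gam i
      + \sum_j coord c j 1 *:K mxC2 eta gam j.
  by congr (_ + _); apply: eq_bigr => i _; rewrite ?alphaE ?betaE.
rewrite {}unitE (twisting_map_coordP dD gamE).
split=> [[g1 gu gM gD] | [BB [C1 [CC [BC [BCu [G01 [G11M [G10M [G11 G10]]]]]]]]]].
  have g0 := lower_triangularP bB cC lamE etaE gBu gu gD.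
  have [BB CC BC] :=
    (twist_mul_at_rshift bB cC lamE etaE _).1 (fun i j q => gD i j (rshift n q)).
  have [_ _ G10 G11] : [/\ coord_mx (gB gam) 1 = 1%:M, (0 : 'M[A]_(n, m)) = 0,
      Gamma10 gam 1 = 0 & Gamma11 gam 1 = 1%:M].
    by apply: eq_block_mx; rewrite -coord_mx_block // g1 scalar_mx_block.
  split; first exact: BB.
  split; first exact/(mxC1_eq0 bB lamE).
  split; first exact: CC.
  split; first exact: BC.
  split; first exact/(twist_unit_rshift (coord b) cC etaE).
  split; first exact/Gamma01_eq0.
  split=> [a a'|].
    have := gM a a'; rewrite !coord_mx_block // mulmx_block => /eq_block_mx.
    by case=> _ _ _ ->; rewrite mulmx0 add0r.
  split=> [a a'|//].
  have := gM a a'; rewrite !coord_mx_block // mulmx_block => /eq_block_mx.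
  by case=> _ _ -> _; rewrite Gamma00E.
have g0 : lower_triangular gam by apply/Gamma01_eq0.
split.
- by rewrite coord_mx_block // gB1 G10 G11 -scalar_mx_block.
- move=> p; case: (split_ordP p) => q ->; last first.
    by move: q; apply/(twist_unit_rshift (coord b) cC etaE).
  rewrite big_split_ord /= [X in _ + X]big1 ?addr0 => [|j _].
    by rewrite prod_duall -gBu; apply: eq_bigr => i _; rewrite prod_duall.
  by rewrite g0 scaler0.
- move=> a a'; rewrite !coord_mx_block // mulmx_block gBM G10M G11M Gamma00E.
  by rewrite !mulmx0 !mul0mx !addr0 add0r.
- move=> i j p; case: (split_ordP p) => q ->.
    exact: (twist_mul_at_lshift bB cC lamE etaE).
  by move: i j q; apply/(twist_mul_at_rshift bB cC lamE etaE).
Qed.
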